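(* Let $G$ be a graph with a near $\alpha$-valuation $p$, with associated partition $V(G)=V_{small}\cup V_{large}$, and let $l$ be a positive integer. Let $G_{1,l}$ be the blow-up of $G$ in which every vertex of $V_{small}$ is replaced by a single vertex and every vertex of $V_{large}$ is replaced by a set of $l$ vertices. Then $G_{1,l}$ admits a near $\alpha$-valuation.
   Context: A $\beta$-valuation of a graph with $n$ edges is an injective $b:V\to\{0,\ldots,n\}$ such that the multiset of edge values $|b(u)-b(v)|$ over all edges $\{u,v\}$ is $\{1,\ldots,n\}$. A near $\alpha$-valuation is a $\beta$-valuation with a partition $V=V_{small}\cup V_{large}$ such that every vertex of $V_{small}$ has label smaller than the labels of all its neighbours and every vertex of $V_{large}$ has label larger than the labels of all its neighbours. A blow-up of a graph $G$ replaces each vertex $s$ by a nonempty set $V_s$ of new vertices, with every vertex of $V_s$ adjacent to every vertex of $V_t$ exactly when $\{s,t\}\in E(G)$ (and no other edges).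
   Formalization: The graph G is assumed to have at least one edge; without this the claim fails for a single isolated vertex placed in V_large with l ≥ 2, whose blow-up has l vertices, no edges and only the label 0 available. *)

(* Defs.v *)
From HB Require Import structures.
From mathcomp Require Import all_boot all_order all_algebra.

Set Implicit Arguments.
Unset Strict Implicit.
Unset Printing Implicit Defensive.

Record sgraph := SGraph {
  vertex :> finType;
  adj : rel vertex;
  adj_sym : symmetric adj;
  adj_irrefl : irreflexive adj }.

Arguments adj {G} : rename.

Definition edges (G : sgraph) : {set {set G}} :=
  [set [set x.1; x.2] | x : G * G & adj x.1 x.2].

Definition num_edges (G : sgraph) : nat := #|edges G|.

(* [`|b u - b v|] is the distance on nat.  The maximum over all pairs of       *)
(* elements of [A] makes the value a function of the unordered pair; see       *)
(* [edge_value2].                                                              *)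
Definition edge_value (G : sgraph) (b : G -> nat) (A : {set G}) : nat :=
  \max_(u in A) \max_(v in A) `|b u - b v|%N.

Lemma edge_value2 (G : sgraph) (b : G -> nat) (u v : G) :
  edge_value b [set u; v] = `|b u - b v|%N.
Proof.
have [-> | neq_uv] := eqVneq u v.
  by rewrite /edge_value setUid !big_set1.
by rewrite /edge_value !big_setU1 ?inE //= !big_set1 !big_setU1 ?inE //=
  !big_set1 !distnn (distnC (b v)) max0n maxn0 maxnn.
Qed.

Definition beta_valuation (G : sgraph) (b : G -> nat) : Prop :=
  [/\ injective b,
      forall v : G, b v <= num_edges G
    & perm_eq [seq edge_value b A | A <- enum (edges G)]
              (iota 1 (num_edges G))].

Definition near_alpha_valuation (G : sgraph) (b : G -> nat)
    (Vsmall Vlarge : {set G}) : Prop :=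
  [/\ beta_valuation b,
      Vsmall :|: Vlarge = [set: G],
      [disjoint Vsmall & Vlarge],
      forall u v : G, u \in Vsmall -> adj u v -> b u < b v
    & forall u v : G, u \in Vlarge -> adj u v -> b v < b u].

Definition has_near_alpha_valuation (G : sgraph) : Prop :=
  exists (b : G -> nat) (Vsmall Vlarge : {set G}),
    near_alpha_valuation b Vsmall Vlarge.

(* Vertex [s] is replaced by [m s] copies [Tagged _ i], [i : 'I_(m s)].  This  *)
(* is a blow-up in the usual sense (nonempty classes) when [m] is positive.    *)
Section Blowup.
Variables (G : sgraph) (m : G -> nat).

Definition blowup_vertex : finType := {s : G & 'I_(m s)}.

Definition blowup_adj : rel blowup_vertex :=
  fun x y => adj (tag x) (tag y).

Lemma blowup_adj_sym : symmetric blowup_adj.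
Proof. by move=> x y; apply: adj_sym. Qed.

Lemma blowup_adj_irrefl : irreflexive blowup_adj.
Proof. by move=> x; apply: adj_irrefl. Qed.

Definition blowup : sgraph := SGraph blowup_adj_sym blowup_adj_irrefl.
End Blowup.

Definition blowup1l (G : sgraph) (Vlarge : {set G}) (l : nat) : sgraph :=
  @blowup G (fun s => if s \in Vlarge then l else 1).

(* Main.v *)
Require Import Defs.
From HB Require Import structures.
From mathcomp Require Import all_boot all_order all_algebra.
From mathcomp Require Import zify.

Set Implicit Arguments.
Unset Strict Implicit.
Unset Printing Implicit Defensive.

(** With [l] copies of every large vertex, give a small vertex [s] the label
    [l * p s] and the [i]-th copy ([0 <= i < l]) of a large vertex [t] the label
    [l * p t - i].  The [l] copies of an edge of value [d] then get the values
    [l * d - i], i.e. the block [l * (d - 1) + 1, ..., l * d], and these blocks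
    tile [1, ..., l * n].  The labels are natural numbers because no large vertex
    has label [0]: the edge of value [n] joins the labels [0] and [n], so the
    vertex labelled [0] has a larger neighbour. *)

Lemma edgesP (G : sgraph) (A : {set G}) :
  reflect (exists u v : G, adj u v /\ A = [set u; v]) (A \in edges G).
Proof.
apply: (iffP imsetP) => [[[u v] uv ->] | [u [v [uv ->]]]].
  by exists u, v; rewrite inE in uv.
by exists (u, v); rewrite ?inE.
Qed.

Lemma edges_ltP (G : sgraph) (b : G -> nat) (A : {set G}) : injective b ->
  reflect (exists u v : G, [/\ adj u v, b u < b v & A = [set u; v]])
          (A \in edges G).
Proof.
move=> b_inj; apply: (iffP (edgesP A)) => [[u [v [uv ->]]] | [u [v [uv _ ->]]]].
  case: (ltngtP (b u) (b v)) => [lt_uv | lt_vu | /b_inj eq_uv].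
  - by exists u, v.
  - by exists v, u; rewrite adj_sym setUC.
  - by rewrite eq_uv adj_irrefl in uv.
by exists u, v.
Qed.

Lemma edge_value_lt (G : sgraph) (b : G -> nat) (u v : G) :
  b u < b v -> edge_value b [set u; v] = b v - b u.
Proof. by move=> lt_uv; rewrite edge_value2 distnEr // ltnW. Qed.

(** The bound [n] is not assumed to be the number of edges: a bijection between edges and
    [1, ..., n] forces this equality, so the edges of the blow-up never have to be counted. *)
Lemma beta_valuation_intro (G : sgraph) (b : G -> nat) (n : nat) :
    injective b -> (forall v, b v <= n) ->
    (forall u v u' v' : G, adj u v -> adj u' v' -> b u < b v -> b u' < b v' ->
       b v - b u = b v' - b u' -> u = u' /\ v = v') ->
    (forall d, 0 < d <= n ->
       exists u v : G, [/\ adj u v, b u < b v & b v - b u = d]) ->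
  beta_valuation b.
Proof.
move=> b_inj b_le val_inj val_surj.
have perm_n: perm_eq [seq edge_value b A | A <- enum (edges G)] (iota 1 n).
  apply: uniq_perm; last 1 first.
  - move=> d; rewrite mem_iota; apply/mapP/idP => [[A] | d_n].
      rewrite mem_enum => /(edges_ltP _ b_inj)[u [v [uv lt_uv ->]]] ->.
      by rewrite edge_value_lt //; have := b_le v; lia.
    have [| u [v [uv lt_uv val_uv]]] := val_surj d; first by lia.
    exists [set u; v]; last by rewrite edge_value_lt.
    by rewrite mem_enum; apply/edgesP; exists u, v.
  - rewrite map_inj_in_uniq ?enum_uniq // => A B; rewrite !mem_enum.
    move=> /(edges_ltP _ b_inj)[u [v [uv lt_uv ->]]].
    move=> /(edges_ltP _ b_inj)[u' [v' [uv' lt_uv' ->]]].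
    rewrite !edge_value_lt // => eq_val.
    by have [-> ->] := val_inj _ _ _ _ uv uv' lt_uv lt_uv' eq_val.
  - exact: iota_uniq.
have num_n: num_edges G = n.
  by rewrite /num_edges cardE -(size_map (edge_value b)) (perm_size perm_n) size_iota.
by split=> //; rewrite num_n.
Qed.

Lemma beta_valuation_edge_inj (G : sgraph) (b : G -> nat) (u v u' v' : G) :
    beta_valuation b -> adj u v -> adj u' v' -> b u < b v -> b u' < b v' ->
  b v - b u = b v' - b u' -> u = u' /\ v = v'.
Proof.
move=> [b_inj _ perm_b] uv uv' lt_uv lt_uv' eq_val.
have /dinjectiveP val_inj: dinjectiveb (edge_value b) (mem (edges G)).
  by rewrite /dinjectiveb /image_mem (perm_uniq perm_b) iota_uniq.
have eq_set: [set u; v] = [set u'; v'].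
  apply: val_inj; last by rewrite !edge_value_lt.
  - by apply/edgesP; exists u, v.
  - by apply/edgesP; exists u', v'.
have: u \in [set u'; v'] by rewrite -eq_set set21.
have: v \in [set u'; v'] by rewrite -eq_set set22.
(* Both edges are oriented upwards, which excludes the crossed and the collapsed matchings of
   endpoints. *)
by case/set2P=> eq_v; case/set2P=> eq_u; subst; split=> //; lia.
Qed.

Lemma beta_valuation_edge_surj (G : sgraph) (b : G -> nat) (d : nat) :
    beta_valuation b -> 0 < d <= num_edges G ->
  exists u v : G, [/\ adj u v, b u < b v & b v - b u = d].
Proof.
move=> [b_inj _ perm_b] d_n.
have: d \in [seq edge_value b A | A <- enum (edges G)].
  by rewrite (perm_mem perm_b) mem_iota; lia.
case/mapP=> A; rewrite mem_enum => /(edges_ltP _ b_inj)[u [v [uv lt_uv ->]]] ->.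
by exists u, v; rewrite edge_value_lt.
Qed.

Lemma large_label_gt0 (G : sgraph) (p : G -> nat) (Vsmall Vlarge : {set G}) :
    0 < num_edges G -> near_alpha_valuation p Vsmall Vlarge ->
  forall t, t \in Vlarge -> 0 < p t.
Proof.
move=> n_gt0 [p_beta _ _ _ p_large] t t_large.
have [|u [v [uv lt_uv val_uv]]] := @beta_valuation_edge_surj _ _ (num_edges G) p_beta.
  by rewrite n_gt0 leqnn.
have [p_inj p_le _] := p_beta.
have pu0: p u = 0 by have := p_le v; lia.
case: (posnP (p t)) => // pt0.
have eq_tu : t = u by apply: p_inj; rewrite pt0 pu0.
by rewrite -eq_tu in uv lt_uv; have := p_large _ _ t_large uv; lia.
Qed.

(** One formula serves both kinds of vertices, since the only copy of a small vertex has index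
    [0]. *)
Definition blowup_label (G : sgraph) (m : G -> nat) (p : G -> nat) (l : nat)
    (x : blowup m) : nat :=
  l * p (tag x) - tagged x.

(* An edgeless one-vertex graph with its vertex in Vlarge satisfies the other
   hypotheses, but its blow-up has l vertices and only the label 0: hence hn. *)
Theorem theorem4p2 (G : sgraph) (p : G -> nat) (Vsmall Vlarge : {set G})
    (l : nat) (hn : 0 < num_edges G)
    (hp : near_alpha_valuation p Vsmall Vlarge) (hl : 0 < l) :
  has_near_alpha_valuation (blowup1l Vlarge l).
Proof.
have large_gt0 := large_label_gt0 hn hp.
have [p_beta VU Vdisj p_small p_large] := hp.
have [p_inj p_le _] := p_beta.
set m := fun s => if s \in Vlarge then l else 1.
rewrite /blowup1l -/m; set H := blowup m.
have m_nlarge s : s \notin Vlarge -> m s = 1 by rewrite /m => /negbTE->.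
have tagged_lt (x : H) : tagged x < m (tag x) by apply: ltn_ord.
have idx_lt (x : H) : tagged x < l.
  by apply: leq_trans (tagged_lt x) _; rewrite /m; case: ifP.
have idx_le (x : H) : tagged x <= l * p (tag x).
  have [x_large | x_nlarge] := boolP (tag x \in Vlarge).
    by have := large_gt0 _ x_large; have := idx_lt x; nia.
  by have := tagged_lt x; have := m_nlarge _ x_nlarge; lia.
have small_or s : (s \in Vsmall) || (s \in Vlarge) by rewrite -in_setU VU inE.
have adj_lt (u v : G) : adj u v -> p u < p v -> u \in Vsmall /\ v \in Vlarge.
  move=> uv lt_uv; split.
    case/orP: (small_or u) => // /p_large/(_ uv); lia.
  case/orP: (small_or v) => // v_small.
  by rewrite adj_sym in uv; have := p_small _ _ v_small uv; lia.
have small_idx (x : H) : tag x \in Vsmall -> tagged x = 0 :> nat.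
  move=> x_small; have := tagged_lt x.
  by have := m_nlarge _ (negbT (disjointFr Vdisj x_small)); lia.
pose b : H -> nat := blowup_label p l.
(* By [idx_le] the subtraction in the label never truncates; the additive form is what the
   arithmetic below uses. *)
have bE (x : H) : b x + tagged x = l * p (tag x).
  by rewrite /b /blowup_label subnK.
(* A gap of at least [1] in [p] becomes a gap of at least [l], and the index subtracted from the
   larger label is below [l]. *)
have lt_b (x y : H) : p (tag x) < p (tag y) -> tag x \in Vsmall -> b x < b y.
  move=> lt_xy /small_idx; have := bE x; have := bE y.
  by have := idx_lt y; nia.
have lt_bW (x y : H) : b x < b y -> p (tag x) <= p (tag y).
  have := bE x; have := bE y; have := idx_lt x; have := idx_lt y; nia.
have H_adj (x y : H) : adj x y -> b x < b y ->
    [/\ p (tag x) < p (tag y), tag x \in Vsmall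
      & b y + tagged y - b x = l * (p (tag y) - p (tag x))].
  move=> xy lt_xy; have xyG : @adj G (tag x) (tag y) by [].
  have lt_p : p (tag x) < p (tag y).
    (* Equal labels would mean equal tags, hence a loop in [G]. *)
    rewrite ltn_neqAle lt_bW // andbT; apply: contraTneq xyG => /p_inj ->.
    by rewrite adj_irrefl.
  have [x_small _] := adj_lt _ _ xyG lt_p; split=> //.
  by have := small_idx _ x_small; have := bE x; have := bE y; nia.
have eq_H (x y : H) : tag x = tag y -> tagged x = tagged y :> nat -> x = y.
  case: x y => [s i] [t j] /= eq_st; case: _ / eq_st j => j eq_ij.
  by congr Tagged; apply: val_inj.
have b_beta : @beta_valuation H b.
  apply: (@beta_valuation_intro _ _ (l * num_edges G)).
  - move=> x y eq_b; have := bE x; have := bE y.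
    have := idx_lt x; have := idx_lt y => lt_y lt_x Ey Ex.
    (* With indices below [l], [l * p (tag x)] is the least multiple of [l] that is at least
       [b x]. *)
    have eq_p : p (tag x) = p (tag y) by nia.
    by apply: eq_H; [apply: p_inj | rewrite eq_p in Ex; lia].
  - by move=> x; have := bE x; have := p_le (tag x); nia.
  - move=> x y x' y' xy xy' lt_xy lt_xy' eq_val.
    have [lt_p x_small Exy] := H_adj _ _ xy lt_xy.
    have [lt_p' x_small' Exy'] := H_adj _ _ xy' lt_xy'.
    (* Both values have the form [l * d - i] with [i < l], so they lie in the same block and come
       from the same edge of [G]. *)
    have eq_d : p (tag y) - p (tag x) = p (tag y') - p (tag x').
      have := idx_lt y; have := idx_lt y'; nia.
    have [eq_x eq_y] :=
      @beta_valuation_edge_inj _ _ _ _ (tag x') (tag y') p_beta xy xy' lt_p lt_p' eq_d.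
    split; apply: eq_H => //; first by rewrite !small_idx.
    by rewrite eq_d in Exy; lia.
  (* Writing [d - 1 = q * l + r] with [r < l] gives [d = l * (q + 1) - (l - 1 - r)]: take the edge
     of [G] of value [q + 1] and the copy of index [l - 1 - r] of its large end. *)
  - move=> d d_range; pose q := d.-1 %/ l; pose i := l.-1 - d.-1 %% l.
    have d_eq := divn_eq d.-1 l; have r_lt := ltn_pmod d.-1 hl.
    have [|s [t [st lt_st val_st]]] := @beta_valuation_edge_surj _ _ q.+1 p_beta.
      rewrite /q /= ltn_divLR //; lia.
    have [s_small t_large] := adj_lt _ _ st lt_st.
    have s_gt0 : 0 < m s by rewrite /m; case: ifP.
    have i_lt : i < m t by rewrite /m t_large /i; lia.
    pose x : H := Tagged (fun s => 'I_(m s)) (Ordinal s_gt0).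
    pose y : H := Tagged (fun s => 'I_(m s)) (Ordinal i_lt).
    have xy : b x < b y by apply: lt_b.
    exists x, y; split=> //.
    have [_ _] := H_adj x y st xy; rewrite /= val_st /i /q; nia.
exists b, [set x | tag x \in Vsmall], [set x | tag x \in Vlarge]; split=> //.
- by apply/setP=> x; rewrite !inE small_or.
- by apply/pred0P=> x /=; rewrite !inE; apply/andP => -[/(disjointFr Vdisj)->].
- by move=> x y; rewrite inE => x_small xy; apply: lt_b; rewrite // p_small.
(* Read from its lower end, which [adj_lt] shows to be small, the edge falls under [lt_b] again. *)
- move=> x y; rewrite inE => x_large xy; have yx : @adj G (tag y) (tag x) by rewrite adj_sym.
  have lt_yx := p_large _ _ x_large xy.
  by apply: lt_b => //; case: (adj_lt _ _ yx lt_yx).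
Qed.
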